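(* Let $r=r(n)$ be an integer-valued function with $r\ge 5$ and $r=o(n^{1/8})$. Let $G(n,r,1)$ be the graph on $[n]^{(r)}$ in which two $r$-subsets are adjacent iff they intersect in exactly one element. For an independent set $A$ of $G(n,r,1)$ let $d(A)=\max_{x\neq y}|\{v\in A: \{x,y\}\subset v\}|$. If $A$ is an independent set in $G(n,r,1)$ with $d(A)\le \binom{tn-2}{r-2}$ for some $t\in(0,1)$, then $$|A|\le \frac{1}{t}\binom{tn-2}{r-2}+o\left(\binom{n-2}{r-2}\right),$$ where the $o(\cdot)$ term is as $n\to\infty$ and does not depend on the particular set $A$.
   Context: For a real number $a$ and a nonnegative integer $b$, $\binom{a}{b}$ is defined as $\frac{a(a-1)\cdots(a-b+1)}{b!}$ (this is used when $tn$ is not an integer). The star centered at distinct elements $x,y$ over $[n]$ is the family of all $r$-subsets of $[n]$ containing both $x$ and $y$; $d(A)$ is the largest size of the intersection of $A$ with a star. *)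

(* Defs.v *)
From HB Require Import structures.
From mathcomp Require Import all_boot all_order all_algebra.
From mathcomp Require Import all_classical all_reals all_analysis.
Set Implicit Arguments. Unset Strict Implicit. Unset Printing Implicit Defensive.
Import Order.TTheory GRing.Theory Num.Theory.
Local Open Scope ring_scope.

Definition gbinom (R : realType) (a : R) (b : nat) : R :=
  (\prod_(i < b) (a - i%:R)) / (b`!)%:R.

Definition is_indep (n k : nat) (A : {set {set 'I_n}}) : Prop :=
  (forall v, v \in A -> #|v| = k) /\
  (forall u v, u \in A -> v \in A -> #|u :&: v| <> 1%N).

Definition dA (n : nat) (A : {set {set 'I_n}}) : nat :=
  \max_(p : 'I_n * 'I_n | p.1 != p.2) #|[set v in A | (p.1 \in v) && (p.2 \in v)]|.

(* Main.v *)
(** For S contained in a member v of the independent set A, if some w in A meets S in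
exactly one point then v meets w outside S, so v contains one of at most r further
points determined by S. Hence every v can be generated from few free points by such
forced extensions. The members in which at most three free points force three
extensions are rare: they number O(r^7 / n) C(n-2, r-2). In any other member v, the
sets closed under forced extension have a least nonempty element, a pair e(v), and
every w in A meeting v contains e(v). Members v, v' that meet therefore have
e(v) = e(v'), so the unexceptional members split into stars living on disjoint vertex
sets V_e, where the star on V_e has size at most |V_e| / (tn) C(tn-2, r-2). *)

Require Import Defs.
From HB Require Import structures.
From mathcomp Require Import all_classical all_reals all_analysis.
From mathcomp Require Import all_boot all_order all_algebra.
From mathcomp Require Import zify ring lra.
Set Implicit Arguments. Unset Strict Implicit. Unset Printing Implicit Defensive.

(** * Counting supersets of a prescribed set *)

Lemma card_bigcup_leq (I T : finType) (P : pred I) (F : I -> {set T}) :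
  #|\bigcup_(i | P i) F i| <= \sum_(i | P i) #|F i|.
Proof.
elim/big_rec2: _ => [|i m X _ leXm]; first by rewrite cards0.
by rewrite (leq_trans (leq_card_setU _ _).1) // leq_add2l.
Qed.

Lemma bin_leq_expn n k : 'C(n, k) <= n ^ k.
Proof.
have ffle : n ^_ k <= n ^ k.
  elim: k => // k IH; rewrite ffactnSr expnSr leq_mul //; exact: leq_subr.
apply: leq_trans ffle; rewrite -bin_ffact; exact/leq_pmulr/fact_gt0.
Qed.

(* The factor (s <= k) avoids the junk value 'C(n - s, 0) = 1 of truncated subtraction. *)
Definition supersets_bound n k s := (s <= k) * 'C(n - s, k - s).

Lemma card_supersets (T : finType) (S V : {set T}) k : S \subset V ->
  #|[set v : {set T} | [&& S \subset v, v \subset V & #|v| == k]]|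
  <= supersets_bound #|V| k #|S|.
Proof.
move=> sSV; rewrite /supersets_bound; set X := [set v | _].
have [lesk|ltks] := leqP #|S| k; last first.
  rewrite mul0n leqn0 cards_eq0; apply/eqP/setP => v; rewrite !inE.
  apply/negbTE/negP => /and3P[/subset_leq_card sSv _ /eqP vk].
  by rewrite vk leqNgt ltks in sSv.
rewrite mul1n.
have inj : {in X &, injective (fun v => v :\: S)}.
  move=> u v; rewrite !inE => /andP[sSu _] /andP[sSv _] eq_uv.
  by rewrite -(setID u S) -(setID v S) eq_uv (setIidPr sSu) (setIidPr sSv).
rewrite -(card_in_imset inj).
have -> : #|V| - #|S| = #|V :\: S| by rewrite cardsD (setIidPr sSV).
rewrite -cards_draws; apply/subset_leq_card/subsetP => u /imsetP[v].
rewrite !inE => /and3P[sSv svV /eqP vk] ->; rewrite setSD //=.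
by rewrite cardsD (setIidPr sSv) vk.
Qed.

(** Prescribing one more point multiplies the bound by [(k - s) / (n - s)], which is at most [k / n]
    because [k <= n]. *)
Lemma supersets_boundS n k s : k <= n ->
  n * supersets_bound n k s.+1 <= k * supersets_bound n k s.
Proof.
move=> lekn; rewrite /supersets_bound.
have [ltsk|] := ltnP s k; last by rewrite mul0n muln0.
rewrite (ltnW ltsk) !mul1n.
have := mul_bin_diag (n - s) (k - s.+1).
have -> : (n - s).-1 = n - s.+1 by lia.
have -> : (k - s.+1).+1 = k - s by lia.
set a := 'C(_, _); set b := 'C(_, _) => eqab.
have ns0 : 0 < n - s by lia.
rewrite -(leq_pmul2l ns0) [X in X <= _]mulnCA eqab !mulnA leq_mul2r.
by apply/orP; right; nia.
Qed.

Lemma supersets_bound_iter n k s i : k <= n ->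
  n ^ i * supersets_bound n k (s + i) <= k ^ i * supersets_bound n k s.
Proof.
move=> lekn; elim: i => [|i IH]; first by rewrite addn0.
rewrite addnS !expnS -!mulnA.
rewrite (leq_trans _ (leq_mul (leqnn k) IH)) // mulnCA [X in _ <= X]mulnCA.
by rewrite leq_mul2l supersets_boundS ?orbT.
Qed.

(** * Least nonempty members of an intersection-closed family *)

(* C is the family of closed subsets of an unexceptional v. Two disjoint minimal
   closed sets would be pairs, and adjoining a fifth point of v would then force a
   closed set that is too large; so there is a unique minimal closed set. *)
Lemma exists_closed_pair (T : finType) (C : pred {set T}) (v : {set T}) :
    4 < #|v| -> (forall X Y, C X -> C Y -> C (X :&: Y)) ->
    (forall x, ~~ C [set x]) -> (forall X, C X -> X \subset v) ->
    (forall I : {set T}, I \subset v -> 0 < #|I| <= 3 ->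
      exists X, [/\ C X, I \subset X & #|X| <= #|I| + 2]) ->
  exists e, [/\ C e, #|e| = 2, e \subset v &
    forall x, x \in v -> exists X, [/\ C X, x \in X & X \subset x |: e]].
Proof.
move=> v5 CI C1 Cv Csmall.
pose D X := C X && (X != set0).
have card_gt1 X : D X -> 1 < #|X|.
  case/andP=> CX; rewrite -card_gt0 => X0; rewrite ltn_neqAle X0 andbT eq_sym.
  by apply: contraL CX => /cards1P[x ->].
have cl1 x : x \in v -> exists X, [/\ C X, x \in X & #|X| <= 3].
  move=> xv; have [||X [CX sX cX]] := Csmall [set x]; rewrite ?sub1set ?cards1 //.
  by exists X; split; rewrite ?cards1 -?sub1set // in cX *.
have cl2 x y : x \in v -> y \in v -> exists X, [/\ C X, x \in X, y \in X & #|X| <= 4].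
  move=> xv yv; have [||X [CX sX cX]] := Csmall [set x; y].
  - by rewrite subUset !sub1set xv.
  - by rewrite cards2; case: (x != y).
  move: sX; rewrite subUset !sub1set => /andP[xX yX]; exists X; split=> //.
  by rewrite cards2 in cX; case: (x != y) in cX; rewrite (leq_trans cX).
(* The set [M :&: X] is closed and nonempty, so minimality makes it all of [M]. *)
have minmeet M X x : minset D M -> C X -> x \in X -> x \in M -> M \subset X.
  case/minsetP=> /andP[CM M0] minM CX xX xM; rewrite -(minM (M :&: X)) ?subsetIl ?subsetIr //.
  by rewrite /D CI //=; apply/set0Pn; exists x; rewrite inE xX xM.
have meet X Y : D X -> D Y -> X :&: Y != set0.
  move=> DX DY; apply/eqP => XY0.
  have [M1 minM1 sM1X] := minset_exists DX; have [M2 minM2 sM2Y] := minset_exists DY.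
  have disj z : z \in M1 -> z \in M2 -> False.
    by move=> /(subsetP sM1X) zX /(subsetP sM2Y) zY; move/setP/(_ z): XY0; rewrite !inE zX zY.
  have DM1 : D M1 by case/minsetP: minM1.
  have DM2 : D M2 by case/minsetP: minM2.
  have [/andP[CM1 /set0Pn[m1 m1M]] /andP[CM2 /set0Pn[m2 m2M]]] := (DM1, DM2).
  have c12 : #|M1 :|: M2| = #|M1| + #|M2|.
    by rewrite cardsU disjoint_setI0 ?cards0 ?subn0 // disjoint_subset; apply/subsetP => z zM1; rewrite inE; apply/negP => /(disj z zM1).
  have v_m1 := subsetP (Cv _ CM1) _ m1M; have v_m2 := subsetP (Cv _ CM2) _ m2M.
  have g1 := card_gt1 _ DM1; have g2 := card_gt1 _ DM2.
  have [Z [CZ m1Z m2Z cZ]] := cl2 _ _ v_m1 v_m2.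
  have s12Z : M1 :|: M2 \subset Z.
    by rewrite subUset (minmeet _ _ m1) // (minmeet _ _ m2).
  (* The set [Z] has at most four points and contains the disjoint [M1] and [M2], each of at least
     two. *)
  have [cM1 cM2] : #|M1| = 2 /\ #|M2| = 2.
    have := leq_trans (subset_leq_card s12Z) cZ; rewrite c12.
    by move: g1 g2; clear; lia.
  have [x xv xM12] : exists2 x, x \in v & x \notin M1 :|: M2.
    apply/subsetPn/negP => /subset_leq_card vle.
    by have := leq_trans v5 (leq_trans vle (leq_trans (subset_leq_card s12Z) cZ)).
  (* The closed set [W] must be [x |: N]. A closed [U] of at most four points through [x] and [n']
     meets [W] in a second point, as singletons are not closed. That point lies in [N], so [U]
     contains [N], [N'] and [x], which are five points. *)
  have absurd N N' n' W z : minset D N -> minset D N' -> n' \in N' -> n' \in v ->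
      C W -> x \in W -> #|W| <= 3 -> z \in W -> z \in N -> #|N| = 2 ->
      #|N :|: N'| = 4 -> x \notin N :|: N' -> False.
    move=> mN mN' n'N' vn' CW xW cW zW zN cN cNN' xNN'.
    have xN : x \notin N by move: xNN'; rewrite inE; case/norP.
    have eqW : W = x |: N.
      apply/esym/eqP; rewrite eqEcard subUset sub1set xW (minmeet _ _ z) //=.
      by rewrite cardsU1 xN cN.
    have [U [CU xU n'U cU]] := cl2 _ _ xv vn'.
    have : D (U :&: W) by rewrite /D CI //=; apply/set0Pn; exists x; rewrite inE xU xW.
    move/card_gt1; rewrite (cardsD1 x) inE xU xW add1n ltnS card_gt0.
    case/set0Pn=> y; rewrite eqW !inE => /and3P[yx yU /orP[yx'|yN]]; first by rewrite yx' in yx.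
    have : x |: (N :|: N') \subset U.
      by rewrite !subUset sub1set xU (minmeet _ _ y) // (minmeet _ _ n').
    by move/subset_leq_card; rewrite cardsU1 xNN' cNN' => /leq_trans/(_ cU).
  have [Z' [CZ' xZ' m1Z' m2Z' cZ']] :
      exists Z', [/\ C Z', x \in Z', m1 \in Z', m2 \in Z' & #|Z'| <= 5].
    have [||Z' [CZ' sZ' cZ']] := Csmall [set x; m1; m2].
    - by rewrite !subUset !sub1set xv v_m1.
    - by rewrite -setUA cardsU1 cards2; case: (x \notin _); case: (m1 != m2).
    move: sZ'; rewrite !subUset !sub1set => /andP[/andP[xZ' m1Z'] m2Z'].
    exists Z'; split=> //; apply: leq_trans cZ' _.
    by rewrite -setUA cardsU1 cards2; case: (x \notin _); case: (m1 != m2).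
  have eqZ' : Z' = x |: (M1 :|: M2).
    apply/esym/eqP; rewrite eqEcard !subUset sub1set xZ' (minmeet _ _ m1) //.
    by rewrite (minmeet _ _ m2) //= cardsU1 xM12 c12 cM1 cM2.
  (* Since [W0] meets [Z'] in a point other than [x], it meets [M1] or [M2]; [absurd] excludes
     both. *)
  have [W0 [CW xW cW]] := cl1 _ xv.
  have : D (W0 :&: Z') by rewrite /D CI //=; apply/set0Pn; exists x; rewrite inE xW xZ'.
  move/card_gt1; rewrite (cardsD1 x) inE xW xZ' add1n ltnS card_gt0.
  case/set0Pn=> z; rewrite eqZ' !inE => /and3P[zx zW /orP[zx'|/orP[zM|zM]]].
  - by rewrite zx' in zx.
  - by apply: (absurd M1 M2 m2 W0 z); rewrite // c12 cM1 cM2.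
  - by apply: (absurd M2 M1 m1 W0 z); rewrite // setUC // c12 cM1 cM2.
have Dmem X x : C X -> x \in X -> D X.
  by move=> CX xX; rewrite /D CX; apply/set0Pn; exists x.
have /set0Pn[x0 x0v] : v != set0 by rewrite -card_gt0 (leq_trans _ v5).
have [X0 [CX0 x0X0 cX0]] := cl1 _ x0v.
have [M minM sMX0] := minset_exists (Dmem _ _ CX0 x0X0).
have DM : D M by case/minsetP: minM.
have sMX X x : C X -> x \in X -> M \subset X.
  move=> CX xX; case/set0Pn: (meet _ _ (Dmem _ _ CX xX) DM) => y /setIP[yX yM].
  exact: minmeet yM.
have CM : C M by case/andP: DM.
(* [X] contains [M], which has at least two points, so the third point [x] exhausts it. *)
have cMle X x : C X -> x \in X -> x \notin M -> #|X| <= 3 -> #|M| = 2 /\ X = x |: M.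
  move=> CX xX xM cX; have sMX1 := sMX _ _ CX xX.
  have sxM : x |: M \subset X by rewrite subUset sub1set xX.
  have cM : #|M| = 2.
    have := leq_trans (subset_leq_card sxM) cX; rewrite cardsU1 xM add1n ltnS => leM.
    by apply/eqP; rewrite eqn_leq leM card_gt1.
  by split=> //; apply/esym/eqP; rewrite eqEcard sxM cardsU1 xM cM.
have cM : #|M| = 2.
  have [x xv xM] : exists2 x, x \in v & x \notin M.
    apply/subsetPn/negP => /subset_leq_card vle.
    by have := leq_trans v5 (leq_trans vle (leq_trans (subset_leq_card sMX0) cX0)).
  by have [X [CX xX cX]] := cl1 _ xv; case: (cMle _ _ CX xX xM cX).
exists M; split=> // [|x xv]; first exact: Cv.
have [xM|xM] := boolP (x \in M); first by exists M; rewrite subsetUr.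
have [X [CX xX cX]] := cl1 _ xv; exists X; split=> //.
by case: (cMle _ _ CX xX xM cX) => _ ->.
Qed.

(** * Forced extensions, closed sets and chains *)

(** With the default [set0], a set that no member of [A] meets exactly once contributes nothing to
    [gen]. *)
Definition witness (T : finType) (A : {set {set T}}) (S : {set T}) : {set T} :=
  odflt set0 [pick w in A | #|w :&: S| == 1].

(* If v is in the independent set A, U is contained in v and some member of A meets U in
   exactly one point, then the chosen witness meets v in a further point. *)
Definition gen (T : finType) (A : {set {set T}}) (S : {set T}) : {set T} :=
  \bigcup_(U in powerset S) witness A U.

Definition closed_in (T : finType) (A : {set {set T}}) (v : {set T}) : pred {set T} :=
  fun S => (S \subset v) && (gen A S :&: v \subset S).

(** The candidates for each new point depend only on the current set, not on [v]; this is what makes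
    the [v] with a long chain countable. *)
Fixpoint chain (T : finType) (A : {set {set T}}) (v : {set T}) k (S : {set T}) :=
  if k is k'.+1 then
    [exists y, [&& y \in gen A S, y \notin S, y \in v & chain A v k' (y |: S)]]
  else true.

(* A chain adds 3 points, each chosen among at most 2 ^ 6 * r, to q <= 3 free
   points; prescribing q + 3 points of v costs (r / n) ^ (q + 1), against n ^ q choices. *)
Definition exceptional (T : finType) (A : {set {set T}}) (v : {set T}) :=
  [exists I : {set T}, [&& I \subset v, 0 < #|I| <= 3 & chain A v 3 I]].

Lemma witnessP (T : finType) (A : {set {set T}}) (S w : {set T}) :
  w \in A -> #|w :&: S| = 1 -> witness A S \in A /\ #|witness A S :&: S| = 1.
Proof.
move=> wA wS; rewrite /witness; case: pickP => [u /andP[uA /eqP uS] //|].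
by move/(_ w); rewrite wA wS eqxx.
Qed.

Lemma card_witness (T : finType) (A : {set {set T}}) (S : {set T}) r :
  (forall v, v \in A -> #|v| = r) -> #|witness A S| <= r.
Proof.
move=> Ar; rewrite /witness; case: pickP => [u /andP[uA _]|_] /=; last by rewrite cards0.
by rewrite Ar.
Qed.

Lemma card_gen (T : finType) (A : {set {set T}}) (S : {set T}) r :
  (forall v, v \in A -> #|v| = r) -> #|gen A S| <= 2 ^ #|S| * r.
Proof.
move=> Ar; apply: leq_trans (card_bigcup_leq _ _) _.
rewrite -card_powerset -sum_nat_const; apply: leq_sum => U _; exact: card_witness.
Qed.

(** Letting [gen] range over all subsets of [S] gives this monotonicity, and with it the stability
    of closed sets under intersection. *)
Lemma genS (T : finType) (A : {set {set T}}) (S S' : {set T}) :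
  S \subset S' -> gen A S \subset gen A S'.
Proof.
move=> sSS'; apply/bigcupsP => U; rewrite inE => sUS; apply: bigcup_sup.
by rewrite inE (subset_trans sUS).
Qed.

Lemma witness_sub_gen (T : finType) (A : {set {set T}}) (U S : {set T}) :
  U \subset S -> witness A U \subset gen A S.
Proof. by move=> sUS; apply: bigcup_sup; rewrite inE. Qed.

Lemma closed_inI (T : finType) (A : {set {set T}}) (v S S' : {set T}) :
  closed_in A v S -> closed_in A v S' -> closed_in A v (S :&: S').
Proof.
move=> /andP[sSv gS] /andP[_ gS']; apply/andP; split.
  exact: subset_trans (subsetIl _ _) sSv.
rewrite subsetI (subset_trans _ gS) ?(subset_trans _ gS') // setSI // genS //.
  exact: subsetIr.
exact: subsetIl.
Qed.

(** Otherwise the witness of [S] meets [v] only inside [S], by closedness, hence in exactly one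
    point, against independence. *)
Lemma closed_in_meet (T : finType) (A : {set {set T}}) (v S w : {set T}) :
    (forall u v, u \in A -> v \in A -> #|u :&: v| <> 1) ->
  v \in A -> w \in A -> closed_in A v S -> #|w :&: S| <> 1.
Proof.
move=> indA vA wA /andP[sSv gS] wS1; have [zA zS1] := witnessP wA wS1.
apply: (indA _ _ zA vA); rewrite -zS1; congr #|pred_of_set _|; apply/eqP.
rewrite eqEsubset (setIS _ sSv) andbT subsetI subsetIl (subset_trans _ gS) //.
by rewrite setSI // witness_sub_gen.
Qed.

(** If all closed supersets are large, [I] itself is not closed, so some forced point of [v] can be
    adjoined; iterate. Contrapositively, a missing chain yields a small closed set. *)
Lemma chain_intro (T : finType) (A : {set {set T}}) (v I : {set T}) k :
    I \subset v ->
    (forall X, closed_in A v X -> I \subset X -> #|I| + k <= #|X|) ->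
  chain A v k I.
Proof.
elim: k I => //= k IH I sIv largeX.
have /subsetPn[y] : ~~ (gen A I :&: v \subset I).
  apply/negP => gI; have := largeX I; rewrite /closed_in sIv gI subxx addnS.
  by rewrite ltnNge leq_addr => /(_ isT isT).
rewrite inE => /andP[yg yv] yI; apply/existsP; exists y; rewrite yg yI yv /=.
apply: IH => [|X CX]; first by rewrite subUset sub1set yv.
rewrite subUset => /andP[_ sIX].
by have := largeX X CX sIX; rewrite cardsU1 yI addSn addnS.
Qed.

(** * Counting exceptional members *)

Lemma card_chain (T : finType) (A : {set {set T}}) r k (S : {set T}) :
    (forall v, v \in A -> #|v| = r) ->
  #|[set v in A | (S \subset v) && chain A v k S]|
  <= (2 ^ (#|S| + k) * r) ^ k * supersets_bound #|T| r (#|S| + k).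
Proof.
move=> Ar; elim: k S => [|k IH] S.
  rewrite expn0 mul1n addn0 -cardsT.
  apply: leq_trans (card_supersets r (subsetT S)).
  apply/subset_leq_card/subsetP => v; rewrite !inE andbT subsetT => /andP[/Ar-> ->].
  by rewrite eqxx.
have := card_bigcup_leq [pred y | (y \in gen A S) && (y \notin S)]
  (fun y => [set v in A | (y |: S \subset v) && chain A v k (y |: S)]).
set X := \bigcup_(y | _) _ => cX.
apply: (@leq_trans #|X|).
  apply/subset_leq_card/subsetP => v; rewrite inE => /and3P[vA sSv /existsP[y]].
  case/and4P=> yg yS yv cv; apply/bigcupP; exists y; first by rewrite inE yg.
  by rewrite inE vA subUset sub1set yv sSv.
(* The sum [#|S| + k.+1] is the same for [y |: S] and [k], so one constant [c] bounds the choices at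
   every step. *)
apply: leq_trans cX _; set c := (2 ^ (#|S| + k.+1) * r).
apply: (@leq_trans (\sum_(y | (y \in gen A S) && (y \notin S))
    c ^ k * supersets_bound #|T| r (#|S| + k.+1))).
  apply: leq_sum => y /andP[_ yS]; have := IH (y |: S).
  by rewrite cardsU1 yS add1n addSnnS.
rewrite sum_nat_const expnS -mulnA leq_mul2r; apply/orP; right.
apply: leq_trans (subset_leq_card _) (leq_trans (card_gen S Ar) _).
  by apply/subsetP => y /andP[].
by rewrite leq_mul2r leq_exp2l // leq_addr orbT.
Qed.

Lemma card_exceptional (T : finType) (A : {set {set T}}) r :
    (forall v, v \in A -> #|v| = r) -> 0 < r <= #|T| ->
  #|T| * #|[set v in A | exceptional A v]|
  <= 3 * ((64 * r) ^ 3 * r ^ 4) * supersets_bound #|T| r 2.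
Proof.
move=> Ar /andP[r0 rT]; set n := #|T|.
pose X (q : 'I_3) := \bigcup_(I : {set T} | #|I| == q.+1)
  [set v in A | (I \subset v) && chain A v 3 I].
have sX : [set v in A | exceptional A v] \subset \bigcup_q X q.
  apply/subsetP => v; rewrite inE => /andP[vA /existsP[I /and3P[sIv /andP[I0 I3] cI]]].
  have q3 : #|I|.-1 < 3 by rewrite prednK.
  apply/bigcupP; exists (Ordinal q3) => //; apply/bigcupP; exists I.
    by rewrite /= prednK.
  by rewrite inE vA sIv.
(* Here [q.+1] is the number of free points. With three forced ones, [2 + q.+2] points are
   prescribed; the [q.+2] beyond two cancel the [n ^ q.+1] choices and the extra factor [n], leaving
   [r ^ q.+2 <= r ^ 4]. *)
have cX q : n * #|X q| <= (64 * r) ^ 3 * r ^ 4 * supersets_bound n r 2.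
  have cI (I : {set T}) : #|I| == q.+1 ->
      #|[set v in A | (I \subset v) && chain A v 3 I]|
      <= (64 * r) ^ 3 * supersets_bound n r (2 + q.+2).
    move/eqP=> cI; apply: leq_trans (card_chain 3 I Ar) _; rewrite cI.
    rewrite [q.+1 + 3]addn3 leq_mul2r leq_exp2r // leq_mul2r.
    by rewrite (@leq_exp2l 2 _ 6) // !ltnS -ltnS ltn_ord !orbT.
  have : #|X q| <= n ^ q.+1 * ((64 * r) ^ 3 * supersets_bound n r (2 + q.+2)).
    apply: leq_trans (card_bigcup_leq _ _) _.
    apply: (@leq_trans (\sum_(I : {set T} | #|I| == q.+1)
      (64 * r) ^ 3 * supersets_bound n r (2 + q.+2))); first exact: leq_sum.
    rewrite sum_nat_const leq_mul2r.
    apply/orP; right; apply: leq_trans (bin_leq_expn _ _).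
    rewrite -card_draws; apply/subset_leq_card/subsetP => I; by rewrite inE.
  move=> leX; apply: leq_trans (leq_mul (leqnn n) leX) _.
  rewrite mulnA -expnS mulnCA -[X in _ <= X]mulnA leq_mul2l; apply/orP; right.
  apply: leq_trans (supersets_bound_iter 2 q.+2 rT) _.
  by rewrite leq_mul2r leq_pexp2l ?orbT // !ltnS -ltnS ltn_ord.
apply: leq_trans (leq_mul (leqnn n) (leq_trans (subset_leq_card sX) (card_bigcup_leq _ _))) _.
rewrite big_distrr /= -!mulnA; 
apply: (@leq_trans (\sum_(q < 3) (64 * r) ^ 3 * r ^ 4 * supersets_bound n r 2)).
  by apply: leq_sum => q _; exact: cX.
by rewrite sum_nat_const card_ord !mulnA.
Qed.

(** * Kernels of unexceptional members *)

(** If [w] through [x] missed [e], it would meet a closed subset of [x |: e] only in [x]. So [w]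
    meets the closed pair [e], and cannot do so in one point. The last clause serves to compare
    kernels. *)
Lemma unexceptional_kernel (T : finType) (A : {set {set T}}) (v : {set T}) :
    (forall u v, u \in A -> v \in A -> #|u :&: v| <> 1) -> 4 < #|v| ->
    v \in A -> ~~ exceptional A v ->
  exists e : {set T}, [/\ #|e| = 2, e \subset v,
    forall x w, x \in v -> w \in A -> x \in w -> e \subset w &
    forall x, x \in v -> witness A [set x] :&: v \subset x |: e].
Proof.
move=> indA v5 vA nexc.
have := @exists_closed_pair T (closed_in A v) v v5.
case=> [X Y|x|X|I sIv I3|e [Ce e2 sev eP]].
- exact: closed_inI.
- apply/negP => Cx; have sxv : [set x] \subset v by case/andP: Cx.
  by apply: (closed_in_meet indA vA vA Cx); rewrite (setIidPr sxv) cards1.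
- by case/andP.
- have /forallPn[X] : ~~ [forall X, (closed_in A v X && (I \subset X)) ==> (#|I| + 3 <= #|X|)].
    apply: contra nexc => /forallP largeX.
    have cI : chain A v 3 I.
      by apply: chain_intro => // X CX sIX; have := largeX X; rewrite CX sIX.
    by apply/existsP; exists I; rewrite sIv I3 cI.
  by rewrite negb_imply addnS -ltnNge ltnS => /andP[/andP[CX sIX] cX]; exists X.
exists e; split=> // [x w xv wA xw|x xv]; have [X [CX xX sX]] := eP x xv.
  have [/eqP we0|we0] := boolP (w :&: e == set0).
    exfalso; apply: (closed_in_meet indA vA wA CX); apply/eqP/cards1P; exists x.
    apply/eqP; rewrite eqEsubset sub1set inE xw xX andbT.
    by rewrite (subset_trans (setIS w sX)) // setIUr we0 setU0 subsetIr.
  have we1 := closed_in_meet indA vA wA Ce.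
  have : 2 <= #|w :&: e| by rewrite ltn_neqAle card_gt0 we0 andbT eq_sym; apply/eqP.
  rewrite -e2 => le; apply/setIidPr/eqP.
  by rewrite eqEcard subsetIr.
apply: subset_trans sX; case/andP: CX => _ /(subset_trans _); apply.
by rewrite setSI // witness_sub_gen // sub1set.
Qed.

(** The witness of [[set x]] contains [x], hence both pairs, as do [v] and [v']. Its traces on [v]
    and [v'] thus place each pair inside the other together with [x]. *)
Lemma unexceptional_kernel_unique (T : finType) (A : {set {set T}}) (v v' e e' : {set T}) x :
    v \in A -> x \in v -> x \in v' -> #|e| = 2 -> #|e'| = 2 ->
    e \subset v -> e' \subset v' ->
    (forall x w, x \in v -> w \in A -> x \in w -> e \subset w) ->
    (forall x, x \in v -> witness A [set x] :&: v \subset x |: e) ->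
    v' \in A ->
    (forall x w, x \in v' -> w \in A -> x \in w -> e' \subset w) ->
    (forall x, x \in v' -> witness A [set x] :&: v' \subset x |: e') ->
  e = e'.
Proof.
move=> vA xv xv' e2 e2' sev sev' kv wv v'A kv' wv'.
have [wA wx] : witness A [set x] \in A /\ #|witness A [set x] :&: [set x]| = 1.
  by apply: witnessP vA _; rewrite (setIidPr _) ?sub1set // cards1.
have {wx} xw : x \in witness A [set x].
  have /card_gt0P[y] : 0 < #|witness A [set x] :&: [set x]| by rewrite wx.
  by case/setIP=> yw /set1P yx; rewrite -{1}yx.
have se'x : e' \subset x |: e.
  by apply: subset_trans (wv _ xv); rewrite subsetI (kv' _ _ xv' wA xw) (kv' _ _ xv' vA xv).
have sex : e \subset x |: e'.
  by apply: subset_trans (wv' _ xv'); rewrite subsetI (kv _ _ xv wA xw) (kv _ _ xv v'A xv').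
have [xe|xe] := boolP (x \in e).
  apply/esym/eqP; rewrite eqEcard e2 e2' andbT (subset_trans se'x) //.
  by rewrite subUset sub1set xe subxx.
apply/eqP; rewrite eqEcard e2 e2' andbT; apply/subsetP => y ye.
move: (subsetP sex y ye); rewrite !inE => /orP[/eqP yx|//].
by rewrite -yx ye in xe.
Qed.

Lemma exists_kernels (T : finType) (A : {set {set T}}) r :
    (forall v, v \in A -> #|v| = r) ->
    (forall u v, u \in A -> v \in A -> #|u :&: v| <> 1) -> 4 < r ->
  exists ker : {set T} -> {set T}, forall v, v \in A -> ~~ exceptional A v ->
    [/\ #|ker v| = 2, ker v \subset v & forall v' x, v' \in A ->
      ~~ exceptional A v' -> x \in v -> x \in v' -> ker v = ker v'].
Proof.
move=> Ar indA r5.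
have /fin_all_exists[ker kerP] (v : {set T}) : exists e : {set T},
    v \in A -> ~~ exceptional A v -> [/\ #|e| = 2, e \subset v,
    forall x w, x \in v -> w \in A -> x \in w -> e \subset w &
    forall x, x \in v -> witness A [set x] :&: v \subset x |: e].
  have [vA|] := boolP (v \in A); last by exists set0.
  have [|nexc] := boolP (exceptional A v); first by exists set0.
  have v5 : 4 < #|v| by rewrite Ar.
  by have [e eP] := unexceptional_kernel indA v5 vA nexc; exists e.
exists ker => v vA nv; have [kv2 skv kv wv] := kerP v vA nv.
split=> // v' x v'A nv' xv xv'; have [kv2' skv' kv' wv'] := kerP v' v'A nv'.
exact: (unexceptional_kernel_unique vA xv xv' kv2 kv2' skv skv' kv wv v'A kv' wv').
Qed.

(** * Classes on disjoint vertex sets, and stars *)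

(** Double counting: members through a common point share their value of [f], so each point is
    covered by at most one fibre. *)
Lemma sum_card_cover_fibers (T I : finType) (F : {set {set T}}) (f : {set T} -> I) :
    (forall v v' x, v \in F -> v' \in F -> x \in v -> x \in v' -> f v = f v') ->
  \sum_i #|cover [set v in F | f v == i]| <= #|T|.
Proof.
move=> fP; under eq_bigr do rewrite -sum1_card big_mkcond /=.
rewrite exchange_big /= -sum1_card; apply: leq_sum => x _.
rewrite -big_mkcond /= sum1_card; apply/card_le1_eqP => i j.
move=> /bigcupP[v]; rewrite inE => /andP[vF /eqP <-] xv.
move=> /bigcupP[v']; rewrite inE => /andP[v'F /eqP <-] xv'.
exact: (fP v' v x).
Qed.

Lemma card_star_leq_dA n (A B : {set {set 'I_n}}) (e : {set 'I_n}) :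
    #|e| = 2 -> B \subset A -> (forall v, v \in B -> e \subset v) ->
  #|B| <= dA A.
Proof.
move=> /eqP/cards2P[x [y [xy ->]]] sBA Be.
pose p : 'I_n * 'I_n := (x, y).
apply: leq_trans (@leq_bigmax_cond _ (fun p : 'I_n * 'I_n => p.1 != p.2)
  (fun p => #|[set v in A | (p.1 \in v) && (p.2 \in v)]|) p xy).
apply/subset_leq_card/subsetP => v vB; rewrite inE (subsetP sBA) //=.
by have := Be v vB; rewrite subUset !sub1set.
Qed.

Lemma supersets_bound2 n k : 1 < k -> supersets_bound n k 2 = 'C(n - 2, k - 2).
Proof. by rewrite /supersets_bound => ->; rewrite mul1n. Qed.

(** * Real binomials and the size of star classes *)

Import Order.TTheory GRing.Theory Num.Theory.
Import numFieldNormedType.Exports.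
Local Open Scope classical_set_scope.
Local Open Scope ring_scope.

Lemma natr_binE (R : realType) m b : (b <= m)%N ->
  ('C(m, b))%:R = gbinom (m%:R : R) b.
Proof.
move=> lebm; rewrite /gbinom.
have -> : \prod_(i < b) (m%:R - i%:R) = (m ^_ b)%:R :> R.
  elim: b lebm => [|b IH] ltbm; first by rewrite big_ord0.
  by rewrite big_ord_recr /= IH 1?ltnW // ffactnSr natrM natrB // ltnW.
by rewrite -bin_ffact natrM mulfK // pnatr_eq0 -lt0n fact_gt0.
Qed.

(** The first factor of the product carries the ratio, since [x / (x + 2)] increases; the other
    factors only grow. The shift by 2 fits the later use at [s - 2]. *)
Lemma gbinom_ratio_mono (R : realType) (a : R) m b :
    (0 < b <= m)%N -> m%:R <= a ->
  (a + 2) * ('C(m, b))%:R <= (m%:R + 2) * gbinom a b.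
Proof.
case: b => // b /andP[_ lebm] lema; rewrite natr_binE // /gbinom !mulrA.
rewrite ler_pM2r ?invr_gt0 ?ltr0n ?fact_gt0 // !big_ord_recl !subr0 !mulrA.
have m0 : 0 <= m%:R :> R by [].
apply: ler_pM => //; last 1 first.
- apply: ler_prod => i _; rewrite lerD2r lema subr_ge0 ler_nat andbT.
  exact: ltnW (leq_trans (ltn_ord (lift ord0 i)) lebm).
- by rewrite mulr_ge0 // addr_ge0 // (le_trans m0).
- apply: prodr_ge0 => i _; rewrite subr_ge0 ler_nat.
  exact: ltnW (leq_trans (ltn_ord (lift ord0 i)) lebm).
- nra.
Qed.

(* Stars on few points are bounded by convexity of the binomial, the others by d(A). *)
Lemma star_class_bound (R : realType) (t : R) n r (B : nat) m :
    (2 < r)%N -> 0 < t -> (B <= 'C(m - 2, r - 2))%N -> (r <= m)%N ->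
    B%:R <= gbinom (t * n%:R - 2) (r - 2) ->
  B%:R * (t * n%:R) <= m%:R * gbinom (t * n%:R - 2) (r - 2).
Proof.
move=> r2 t0 BC rm BG; set s := t * n%:R in BG *.
have s0 : 0 <= s by rewrite mulr_ge0 // ltW.
have [sm|ms] := leP s m%:R.
  by rewrite mulrC ler_pM.
have m2 : (2 <= m)%N by apply: leq_trans rm; exact: ltnW.
have := @gbinom_ratio_mono R (s - 2) (m - 2) (r - 2).
rewrite natrB // !subrK subn_gt0 r2 leq_sub2r // lerD2r ltW // => /(_ isT isT).
by apply: le_trans; rewrite mulrC ler_wpM2l // ler_nat.
Qed.

(** Summing the class bounds over [e], with the vertex sets disjoint, gives [t * n] times the count
    at most [n * G]. *)
Lemma card_unexceptional (R : realType) (t : R) n r (A : {set {set 'I_n}}) :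
    (4 < r)%N -> 0 < t -> (0 < n)%N -> is_indep r A ->
    (dA A)%:R <= gbinom (t * n%:R - 2) (r - 2) ->
  #|[set v in A | ~~ exceptional A v]|%:R <= t^-1 * gbinom (t * n%:R - 2) (r - 2).
Proof.
move=> r5 t0 n0 [Ar indA] dG; set G := gbinom _ _ in dG *.
set N := [set v in A | _].
have [ker kerP] := exists_kernels Ar indA r5.
pose Nf e := [set v in N | ker v == e].
have G0 : 0 <= G by apply: le_trans dG.
have sumV : (\sum_e #|cover (Nf e)| <= n)%N.
  rewrite -[X in (_ <= X)%N]card_ord; apply: sum_card_cover_fibers => v v' x.
  rewrite !inE => /andP[vA nv] /andP[v'A nv'] xv xv'.
  by have [_ _ kv] := kerP v vA nv; exact: kv nv' xv xv'.
have classP e : #|Nf e|%:R * (t * n%:R) <= #|cover (Nf e)|%:R * G.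
  have [->|/set0Pn[v]] := eqVneq (Nf e) set0.
    by rewrite cards0 mul0r mulr_ge0.
  rewrite !inE => /andP[/andP[vA nv] /eqP kve].
  have [kv2 _ _] := kerP v vA nv; rewrite kve in kv2.
  have NfP w : w \in Nf e -> [/\ w \in A, e \subset w & w \subset cover (Nf e)].
    move=> wN; move: (wN); rewrite !inE => /andP[/andP[wA nw] /eqP kwe].
    have [_ skw _] := kerP w wA nw; split=> //; first by rewrite -kwe.
    exact: (bigcup_sup w wN).
  have [_ sev svV] : [/\ v \in A, e \subset v & v \subset cover (Nf e)].
    by apply: NfP; rewrite !inE vA nv kve eqxx.
  apply: star_class_bound => //.
  - exact: ltn_trans r5.
  - rewrite -supersets_bound2 ?(ltn_trans _ r5) // -[X in supersets_bound _ _ X]kv2.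
    apply: leq_trans (card_supersets r (subset_trans sev svV)).
    apply/subset_leq_card/subsetP => w /NfP[wA sew swV].
    by rewrite inE sew swV (Ar _ wA) eqxx.
  - by rewrite -(Ar _ vA) subset_leq_card.
  - apply: le_trans dG; rewrite ler_nat.
    apply: (card_star_leq_dA kv2) => [|w /NfP[] //].
    by apply/subsetP => w /NfP[].
have tn0 : 0 < t * n%:R by rewrite mulr_gt0 // ltr0n.
rewrite -(ler_pM2r tn0).
have -> : t^-1 * G * (t * n%:R) = n%:R * G by field; rewrite gt_eqF.
have -> : #|N| = (\sum_e #|Nf e|)%N.
  rewrite -sum1_card (partition_big ker predT) //=.
  by apply: eq_bigr => e _; rewrite -sum1_card; apply: eq_bigl => v; rewrite [in RHS]inE.
rewrite natr_sum mulr_suml; apply: le_trans (ler_sum _ (fun e _ => classP e)) _.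
by rewrite -mulr_suml -natr_sum ler_wpM2r // ler_nat.
Qed.

(** * Assembling the bound with a uniform error term *)

Theorem theorem5 (R : realType) (r : nat -> nat)
  (hr5 : forall n, (5 <= r n)%N)
  (hro : (fun n : nat => (r n)%:R / ((n%:R : R) `^ (1 / 8))) @ \oo --> (0 : R)) :
  exists eps : nat -> R, eps @ \oo --> (0 : R) /\
  forall (n : nat) (t : R) (A : {set {set 'I_n}}),
    0 < t < 1 ->
    is_indep (r n) A ->
    (dA A)%:R <= gbinom (t * n%:R - 2) (r n - 2) ->
    (#|A|)%:R <= t^-1 * gbinom (t * n%:R - 2) (r n - 2)
                 + eps n * ('C(n - 2, r n - 2))%:R.
Proof.
pose q n := (r n)%:R / ((n%:R : R) `^ (1 / 8)).
(* The exceptional members cost [3 * 64 ^+ 3 * r ^+ 7 / n]; since [r >= 1] this is at most the same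
   multiple of [r ^+ 8 / n], which is [q n ^+ 8]. *)
exists (fun n => 3 * 64 ^+ 3 * q n ^+ 8); split.
  rewrite -[X in _ --> X](mulr0 (3 * 64 ^+ 3)); apply: cvgMl_tmp.
  rewrite -[X in _ --> X](expr0n R 8).
  exact: (@continuous_cvg _ _ _ _ _ _ (fun x : R => x ^+ 8) _ (@exprn_continuous _ 8 0) hro).
move=> n t A /andP[t0 t1] indA dG.
have G0 : 0 <= gbinom (t * n%:R - 2) (r n - 2) by apply: le_trans dG.
have q0 : 0 <= q n by rewrite divr_ge0 // powR_ge0.
(* For [n < r n] there are no [r n]-subsets; this also disposes of [n = 0]. *)
have [nr|rn] := ltnP n (r n).
  have -> : A = set0.
    apply/setP => v; rewrite inE; apply/negP => vA.
    by have := max_card [in v]; rewrite (indA.1 v vA) card_ord leqNgt nr.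
  rewrite cards0; apply: addr_ge0; first by rewrite mulr_ge0 // invr_ge0 ltW.
  by rewrite mulr_ge0 // mulr_ge0 // exprn_ge0.
have n0 : (0 < n)%N by apply: leq_trans rn; exact: leq_trans (hr5 n).
have r0 : (0 < r n)%N by apply: leq_trans (hr5 n).
rewrite -(cardsID [set v in A | ~~ exceptional A v] A) natrD lerD //.
  rewrite (setIidPr _); last by apply/subsetP => v; rewrite inE => /andP[].
  exact: card_unexceptional.
have -> : A :\: [set v in A | ~~ exceptional A v] = [set v in A | exceptional A v].
  by apply/setP => v; rewrite !inE; case: (v \in A); rewrite //= ?negbK andbT.
set E := #|_|; set c := 'C(_, _).
have leE : n%:R * E%:R <= 3 * ((64 * (r n)%:R) ^+ 3 * (r n)%:R ^+ 4) * c%:R :> R.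
  have := card_exceptional indA.1; rewrite card_ord r0 rn => /(_ isT).
  rewrite supersets_bound2 ?(leq_trans _ (hr5 n)) // => leE.
  by rewrite -[64 * _]natrM -!natrX -!natrM ler_nat.
have nn0 : 0 < n%:R :> R by rewrite ltr0n.
rewrite -(ler_pM2l nn0) (le_trans leE) // [X in _ <= X]mulrA; apply: ler_wpM2r; first exact: ler0n.
have -> : q n ^+ 8 = (r n)%:R ^+ 8 / n%:R.
  rewrite expr_div_n; congr (_ / _).
  by rewrite -powR_mulrn ?powR_ge0 // -powRrM mul1r mulVf ?powRr1.
have -> : n%:R * (3 * 64 ^+ 3 * ((r n)%:R ^+ 8 / n%:R)) = 3 * 64 ^+ 3 * (r n)%:R ^+ 8 :> R.
  by field; rewrite gt_eqF.
have -> x : 3 * ((64 * x) ^+ 3 * x ^+ 4) = 3 * 64 ^+ 3 * x ^+ 7 :> R by ring.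
by rewrite ler_wpM2l ?mulr_ge0 ?exprn_ge0 // ler_weXn2l // ler1n.
Qed.
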